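(* Let $\phi\colon M\to S^3\times S^3$ be a simply connected almost complex surface in the nearly Kähler $S^3\times S^3$, let $\epsilon\colon M\to\mathbb R^3$ be its associated map, and let $(u,v)$ be isothermal coordinates on $M$ with $\phi_v=J\phi_u$, $z=u+iv$. Then the coordinates $(u,v)$ are isothermal on $\epsilon$ (i.e. $\epsilon_u\cdot\epsilon_u=\epsilon_v\cdot\epsilon_v$ and $\epsilon_u\cdot\epsilon_v=0$) if and only if $\Lambda\,dz^2=g(P\phi_z,\phi_z)\,dz^2$ vanishes. In this case $\epsilon$ is a surface in $\mathbb R^3$ with constant mean curvature $H=-2/\sqrt3$.
   Context: $S^3$ is the set of unit quaternions; tangent vectors at $(p,q)\in S^3\times S^3$ are written $Z=(U,V)$ with $U\in T_pS^3$, $V\in T_qS^3$. The nearly Kähler structure consists of $JZ=\frac{1}{\sqrt3}\bigl(2pq^{-1}V-U,\,-2qp^{-1}U+V\bigr)$ and $g(Z,Z')=\frac12\bigl(\langle Z,Z'\rangle+\langle JZ,JZ'\rangle\bigr)$, where $\langle\cdot,\cdot\rangle$ is the standard product metric. The almost product structure is $PZ=(pq^{-1}V,\,qp^{-1}U)$. An almost complex surface is an immersion $\phi=(p,q)\colon M\to S^3\times S^3$ of a 2-manifold with $J$-invariant tangent spaces. Isothermal coordinates $(u,v)$ for the metric induced by $g$ are chosen so that $\phi_v=J\phi_u$. Put $\phi_z=\frac12(\phi_u-i\phi_v)$, with $g$ and $P$ extended complex (bi)linearly. Imaginary quaternions are identified with $\mathbb R^3$, with inner product $\cdot$ and vector product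 $\times$. Let $\tilde\alpha=p^{-1}p_u$, $\tilde\beta=p^{-1}p_v$ ($\mathbb R^3$-valued), and, with $\theta=2\pi/3$, $\alpha=\cos\theta\,\tilde\alpha+\sin\theta\,\tilde\beta$, $\beta=-\sin\theta\,\tilde\alpha+\cos\theta\,\tilde\beta$. When $M$ is simply connected, the $\mathbb R^3$-valued form $\alpha\,du+\beta\,dv$ is globally defined and exact, and the associated map is a function $\epsilon\colon M\to\mathbb R^3$ (unique up to translation) with $\epsilon_u=\alpha$, $\epsilon_v=\beta$. Mean curvature (half the trace of the second fundamental form) is taken with respect to the unit normal $\epsilon_u\times\epsilon_v/|\epsilon_u\times\epsilon_v|$, so that in isothermal coordinates $\epsilon_{uu}+\epsilon_{vv}=2H\,\epsilon_u\times\epsilon_v$. *)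

(* Defs.v *)
From HB Require Import structures.
From mathcomp Require Import all_boot all_order all_algebra.
From mathcomp Require Import complex.
From mathcomp Require Import all_classical all_reals all_analysis.

Set Implicit Arguments.
Unset Strict Implicit.
Unset Printing Implicit Defensive.

Import Order.TTheory GRing.Theory Num.Theory.
Import numFieldNormedType.Exports.

Local Open Scope classical_set_scope.
Local Open Scope ring_scope.

(* For A open this is the usual class C^k; derivatives are taken in the        *)
(* ambient plane, so only the values of f near A matter.                       *)
Fixpoint Ck_on (R : realType) (W : normedModType R) (k : nat)
    (A : set 'rV[R]_2) (f : 'rV[R]_2 -> W) : Prop :=
  {in A, continuous f} /\
  if k is k'.+1 then
    forall i : 'I_2, {in A, forall a, derivable f a (delta_mx 0 i)} /\
                     Ck_on k' A ('D_(delta_mx 0 i) f)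
  else True.

Definition smooth_on (R : realType) (W : normedModType R)
    (A : set 'rV[R]_2) (f : 'rV[R]_2 -> W) : Prop :=
  forall k, Ck_on k A f.

(* cmap and cinv are total functions; outside cdom, resp. its image, their     *)
(* values are irrelevant.                                                      *)
Record chart (R : realType) (M : topologicalType) := Chart {
  cdom : set M;
  cmap :> M -> 'rV[R]_2;
  cinv : 'rV[R]_2 -> M;
  cdom_open : open cdom;
  cimg_open : open (cmap @` cdom);
  cmapK : {in cdom, cancel cmap cinv};
  cmap_continuous : {within cdom, continuous cmap};
  cinv_continuous : {within cmap @` cdom, continuous cinv} }.

Definition compatible (R : realType) (M : topologicalType)
    (c d : chart R M) : Prop :=
  smooth_on (c @` (cdom c `&` cdom d)) (d \o cinv c) /\
  smooth_on (d @` (cdom c `&` cdom d)) (c \o cinv d).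

Record smooth_surface (R : realType) (M : topologicalType) := SmoothSurface {
  charts : set (chart R M);
  surface_hausdorff : hausdorff_space M;
  surface_second_countable : @second_countable M;
  charts_cover : \bigcup_(c in charts) cdom c = [set: M];
  charts_compatible : forall c d, charts c -> charts d -> compatible c d;
  charts_maximal :
    forall c, (forall d, charts d -> compatible c d) -> charts c }.

Definition simply_connected (R : realType) (M : topologicalType) : Prop :=
  (forall x y : M, exists gamma : R -> M,
     [/\ {within `[0, 1], continuous gamma}, gamma 0 = x & gamma 1 = y]) /\
  (forall gamma : R -> M,
     {within `[0, 1], continuous gamma} -> gamma 0 = gamma 1 ->
     exists h : R * R -> M,
       [/\ {within `[0, 1] `*` `[0, 1], continuous h},
           forall t : R, t \in `[0, 1] -> h (0, t) = gamma t,
           forall t : R, t \in `[0, 1] -> h (1, t) = gamma 0 &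
           forall s : R, s \in `[0, 1] -> h (s, 0) = gamma 0 /\ h (s, 1) = gamma 0]).

(* The derivative of f along the i-th coordinate vector field of c, again as a *)
(* function on M, so that it can be iterated; meaningful on cdom c.            *)
Definition pd (R : realType) (M : topologicalType) (W : normedModType R)
    (c : chart R M) (i : 'I_2) (f : M -> W) : M -> W :=
  fun m => 'D_(delta_mx 0 i) (f \o cinv c) (c m).

Notation pd_u c f := (pd c 0 f).
Notation pd_v c f := (pd c 1 f).

Definition dot (R : realType) (n : nat) (x y : 'rV[R]_n) : R :=
  \sum_i x 0 i * y 0 i.

(* Indices in 'I_3 are added modulo 3.                                         *)
Definition cross (R : realType) (x y : 'rV[R]_3) : 'rV[R]_3 :=
  \row_(k < 3) (x 0 (k + 1) * y 0 (k + 2) - x 0 (k + 2) * y 0 (k + 1)).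

(* Quaternions: the first coordinate is the real part, the other three are the *)
(* coordinates of the imaginary part along i, j, k.                            *)
Notation quat R := ('rV[R]_(1 + 3)).

Definition mkquat (R : realType) (a : R) (v : 'rV[R]_3) : quat R :=
  row_mx a%:M v.
Definition qre (R : realType) (x : quat R) : R := (lsubmx x : 'rV[R]_1) 0 0.
Definition qim (R : realType) (x : quat R) : 'rV[R]_3 := rsubmx x.

Definition qmul (R : realType) (x y : quat R) : quat R :=
  mkquat (qre x * qre y - dot (qim x) (qim y))
         (qre x *: qim y + qre y *: qim x + cross (qim x) (qim y)).
Definition qconj (R : realType) (x : quat R) : quat R :=
  mkquat (qre x) (- qim x).
Definition qinv (R : realType) (x : quat R) : quat R :=
  (dot x x)^-1 *: qconj x.

Definition S3 (R : realType) : set (quat R) := [set x | dot x x = 1].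

Section NearlyKaehler.
Variable R : realType.
Local Notation tvec := (quat R * quat R)%type.
Implicit Types (p q : quat R) (Z : tvec).

Definition nkJ p q Z : tvec :=
  ((Num.sqrt 3)^-1 *: (2 *: qmul (qmul p (qinv q)) Z.2 - Z.1),
   (Num.sqrt 3)^-1 *: ((- 2) *: qmul (qmul q (qinv p)) Z.1 + Z.2)).

Definition nkP p q Z : tvec :=
  (qmul (qmul p (qinv q)) Z.2, qmul (qmul q (qinv p)) Z.1).

Definition prod_metric Z Z' : R := dot Z.1 Z'.1 + dot Z.2 Z'.2.

Definition nkg p q Z Z' : R :=
  2^-1 * (prod_metric Z Z' + prod_metric (nkJ p q Z) (nkJ p q Z')).

(* Complexified tangent vectors X + i Y.                                       *)
Record ctvec := CTvec { ctre : tvec; ctim : tvec }.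

Definition nkPC p q (Z : ctvec) : ctvec :=
  CTvec (nkP p q (ctre Z)) (nkP p q (ctim Z)).

(* Complex bilinear, not hermitian.                                            *)
Definition nkgC p q (Z Z' : ctvec) : R[i] :=
  Complex (nkg p q (ctre Z) (ctre Z') - nkg p q (ctim Z) (ctim Z'))
          (nkg p q (ctre Z) (ctim Z') + nkg p q (ctim Z) (ctre Z')).

End NearlyKaehler.

Section AlmostComplexSurfaces.
Variables (R : realType) (M : topologicalType).
Implicit Types (S : smooth_surface R M) (c : chart R M) (p q : M -> quat R).

Definition smooth_map (W : normedModType R) S (f : M -> W) : Prop :=
  forall c, charts S c -> smooth_on (c @` cdom c) (f \o cinv c).

(* phi = (p, q) is given by its two components; this is phi_u for i = 0 and    *)
(* phi_v for i = 1.                                                            *)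
Definition dphi c p q (i : 'I_2) (m : M) : quat R * quat R :=
  (pd c i p m, pd c i q m).

Definition tangent_space c p q (m : M) : set (quat R * quat R) :=
  [set a *: dphi c p q 0 m + b *: dphi c p q 1 m | a in [set: R] & b in [set: R]].

Definition immersion_S3S3 S p q : Prop :=
  [/\ forall m, S3 (p m) /\ S3 (q m),
      smooth_map S p, smooth_map S q &
      forall c m, charts S c -> cdom c m -> forall a b : R,
        a *: dphi c p q 0 m + b *: dphi c p q 1 m = 0 -> a = 0 /\ b = 0].

Definition almost_complex_surface S p q : Prop :=
  immersion_S3S3 S p q /\
  forall c m, charts S c -> cdom c m ->
    nkJ (p m) (q m) @` tangent_space c p q m `<=` tangent_space c p q m.

Definition induced_metric c p q (i j : 'I_2) (m : M) : R :=
  nkg (p m) (q m) (dphi c p q i m) (dphi c p q j m).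

(* Isothermal coordinates (u, v) = c with phi_v = J phi_u.                     *)
Definition isothermal_adapted c p q : Prop :=
  forall m, cdom c m ->
    [/\ induced_metric c p q 0 0 m = induced_metric c p q 1 1 m,
        induced_metric c p q 0 1 m = 0 &
        dphi c p q 1 m = nkJ (p m) (q m) (dphi c p q 0 m)].

Definition phi_z c p q (m : M) : ctvec R :=
  CTvec (2^-1 *: dphi c p q 0 m) (- 2^-1 *: dphi c p q 1 m).

(* The coefficient of the quadratic differential Lambda dz^2 for z = u + i v.  *)
Definition Lambda c p q (m : M) : R[i] :=
  nkgC (p m) (q m) (nkPC (p m) (q m) (phi_z c p q m)) (phi_z c p q m).

(* p^-1 p_u and p^-1 p_v are imaginary since p takes values in S3.             *)
Definition alpha_tilde c p (m : M) : 'rV[R]_3 :=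
  qim (qmul (qinv (p m)) (pd_u c p m)).
Definition beta_tilde c p (m : M) : 'rV[R]_3 :=
  qim (qmul (qinv (p m)) (pd_v c p m)).

Definition theta : R := 2 * pi / 3.

Definition alpha c p (m : M) : 'rV[R]_3 :=
  cos theta *: alpha_tilde c p m + sin theta *: beta_tilde c p m.
Definition beta c p (m : M) : 'rV[R]_3 :=
  - sin theta *: alpha_tilde c p m + cos theta *: beta_tilde c p m.

Definition associated_map S p q (eps : M -> 'rV[R]_3) : Prop :=
  forall c, charts S c -> isothermal_adapted c p q ->
  forall m, cdom c m ->
    is_derive (c m) (delta_mx 0 0) (eps \o cinv c) (alpha c p m) /\
    is_derive (c m) (delta_mx 0 1) (eps \o cinv c) (beta c p m).

Section SurfacesInSpace.
Variables (c : chart R M) (f : M -> 'rV[R]_3).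

Definition isothermal_on : Prop :=
  forall m, cdom c m ->
    dot (pd_u c f m) (pd_u c f m) = dot (pd_v c f m) (pd_v c f m) /\
    dot (pd_u c f m) (pd_v c f m) = 0.

Definition immersed_in_chart : Prop :=
  smooth_on (c @` cdom c) (f \o cinv c) /\
  forall m, cdom c m -> forall a b : R,
    a *: pd_u c f m + b *: pd_v c f m = 0 -> a = 0 /\ b = 0.

Definition unit_normal (m : M) : 'rV[R]_3 :=
  let n := cross (pd_u c f m) (pd_v c f m) in (Num.sqrt (dot n n))^-1 *: n.

Definition first_form (m : M) : 'M[R]_2 :=
  \matrix_(i, j) dot (pd c i f m) (pd c j f m).

Definition second_form (m : M) : 'M[R]_2 :=
  \matrix_(i, j) dot (pd c j (pd c i f) m) (unit_normal m).

(* Half the metric trace of the second fundamental form.                       *)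
Definition mean_curvature (m : M) : R :=
  \tr (invmx (first_form m) *m second_form m) / 2.

End SurfacesInSpace.

End AlmostComplexSurfaces.

Arguments theta R : clear implicits.

(* Main.v *)
Require Import Defs.
From HB Require Import structures.
From mathcomp Require Import all_boot all_order all_algebra.
From mathcomp Require Import complex.
From mathcomp Require Import all_classical all_reals all_analysis.
From mathcomp Require Import ring lra.

Import Order.TTheory GRing.Theory Num.Theory.
Import numFieldNormedType.Exports.
Local Open Scope classical_set_scope.
Local Open Scope ring_scope.

(** Let a = p^-1 p_u and b = p^-1 p_v be the logarithmic derivatives of the first
    factor, a' and b' those of the second one, and s = sqrt 3. In left
    trivializations the condition that phi_v is J phi_u is linear with constant
    coefficients and says a' = (a + s b) / 2 and b' = (b - s a) / 2, that is,
    a' - i b' = e^(i pi/3) (a - i b) ([nkJ_frame]). Everything follows from this.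

    First, the metric and P also have constant coefficients in left
    trivializations, so Lambda is a constant times the complex square of a - i b
    ([nkgC_nkPC_frame]). The partial derivatives of the associated map are a
    rotation of (a, b) by a constant angle, which multiplies the complex square by
    a number of modulus one; Lambda is in fact -2 times the square of
    (eps_u - i eps_v) / 2 ([Lambda_epsE]), whose real and imaginary parts are the
    two conditions for isothermal coordinates.

    Second, the Maurer-Cartan equation of the 3-sphere ([maurer_cartan]) gives
    a_v - b_u = 2 a x b and a'_v - b'_u = 2 a' x b'. Since a' x b' = a x b, inserting
    a' and b' turns the second equation into the divergence equation
    a_u + b_v = (2 / s) a x b ([divergence_logd]). The Laplacian of the associated
    map is cos theta (a_u + b_v) - sin theta (a_v - b_u), which is therefore
    -(4 / s) a x b = -(4 / s) eps_u x eps_v ([eps_laplacian]). In isothermal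
    coordinates the Laplacian is 2 H eps_u x eps_v
    ([mean_curvature_isothermal]), so H = -2 / s.

    The Maurer-Cartan equation rests on the symmetry of second derivatives,
    obtained from the mean value theorem ([derive_comm]). The associated map is
    only given through its partial derivatives, so its smoothness has to be
    recovered from theirs ([smooth_on_of_partials]). *)

(** * Quaternions in coordinates *)

Section QuaternionCoordinates.
Context {R : realType}.
Implicit Types (x y z : quat R) (u v w : 'rV[R]_3) (a b : R).

Lemma row3P u v : u 0 0 = v 0 0 -> u 0 1 = v 0 1 -> u 0 2 = v 0 2 -> u = v.
Proof.
move=> h0 h1 h2; apply/rowP => -[[|[|[|//]]] hi].
- by rewrite (_ : Ordinal hi = 0) //; apply/val_inj.
- by rewrite (_ : Ordinal hi = 1) //; apply/val_inj.
- by rewrite (_ : Ordinal hi = 2) //; apply/val_inj.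
Qed.

Lemma quatP x y : qre x = qre y -> qim x = qim y -> x = y.
Proof.
rewrite /qre /qim => hre him; rewrite -(hsubmxK x) -(hsubmxK y) him.
by congr row_mx; apply/rowP => i; rewrite ord1.
Qed.

Lemma qre_mkquat a v : qre (mkquat a v) = a.
Proof. by rewrite /qre row_mxKl mxE. Qed.

Lemma qim_mkquat a v : qim (mkquat a v) = v.
Proof. exact: row_mxKr. Qed.

Lemma qre0 : qre (0 : quat R) = 0. Proof. by rewrite /qre !mxE. Qed.
Lemma qim0 : qim (0 : quat R) = 0. Proof. exact: linear0. Qed.
Lemma qreD x y : qre (x + y) = qre x + qre y. Proof. by rewrite /qre !mxE. Qed.
Lemma qreN x : qre (- x) = - qre x. Proof. by rewrite /qre !mxE. Qed.
Lemma qreZ a x : qre (a *: x) = a * qre x. Proof. by rewrite /qre !mxE. Qed.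
Lemma qimD x y : qim (x + y) = qim x + qim y. Proof. exact: linearD. Qed.
Lemma qimN x : qim (- x) = - qim x. Proof. exact: linearN. Qed.
Lemma qimZ a x : qim (a *: x) = a *: qim x. Proof. exact: linearZ. Qed.

Lemma dot3E u v : dot u v = u 0 0 * v 0 0 + u 0 1 * v 0 1 + u 0 2 * v 0 2.
Proof.
rewrite /dot !big_ord_recl big_ord0 addr0 addrA.
by congr (_ * _ + _ * _ + _ * _); congr (_ _ _); apply/val_inj.
Qed.

Lemma dotqE x y : dot x y = qre x * qre y + dot (qim x) (qim y).
Proof.
rewrite /dot big_split_ord /= big_ord1 /qre /qim !mxE.
by congr (_ + _); apply: eq_bigr => i _; rewrite !mxE.
Qed.

Lemma crossE u v :
  (cross u v 0 0 = u 0 1 * v 0 2 - u 0 2 * v 0 1) *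
  (cross u v 0 1 = u 0 2 * v 0 0 - u 0 0 * v 0 2) *
  (cross u v 0 2 = u 0 0 * v 0 1 - u 0 1 * v 0 0).
Proof.
rewrite !mxE.
by split; [split|]; congr (_ * _ - _ * _); congr (_ _ _); apply/val_inj.
Qed.

Definition qimE := (qre_mkquat, qim_mkquat, qreD, qreN, qreZ, qre0, qimD, qimN, qimZ, qim0).

Lemma coordD u v i : (u + v) 0 i = u 0 i + v 0 i. Proof. by rewrite mxE. Qed.
Lemma coordN u i : (- u) 0 i = - u 0 i. Proof. by rewrite mxE. Qed.
Lemma coordZ a u i : (a *: u) 0 i = a * u 0 i. Proof. by rewrite mxE. Qed.
Lemma coord0 i : (0 : 'rV[R]_3) 0 i = 0. Proof. by rewrite mxE. Qed.

Definition coordE := (coordD, coordN, coordZ, coord0).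

End QuaternionCoordinates.

(** Reduces an identity between quaternions, vectors or scalars to polynomial
    identities between real coordinates, which are left to [ring]. *)
Ltac coords :=
  rewrite /qmul /qconj; try (apply: quatP); try (apply: row3P);
  rewrite ?qimE; repeat (progress rewrite ?(crossE, dotqE, dot3E, coordE, qimE)).

Section QuaternionAlgebra.
Context {R : realType}.
Implicit Types (x y z : quat R) (u v w : 'rV[R]_3) (a b : R).

Lemma qmulA x y z : qmul x (qmul y z) = qmul (qmul x y) z.
Proof. coords; ring. Qed.

Lemma qmul_conjl x : qmul (qconj x) x = mkquat (dot x x) 0.
Proof. coords; ring. Qed.

Lemma qmul_conjr x : qmul x (qconj x) = mkquat (dot x x) 0.
Proof. coords; ring. Qed.

Lemma qmul_reall a x : qmul (mkquat a 0) x = a *: x.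
Proof. coords; ring. Qed.

Lemma dot_qmul x y z : dot (qmul x y) (qmul x z) = dot x x * dot y z.
Proof. coords; ring. Qed.

End QuaternionAlgebra.

(** * Inner products and bilinearity *)

Section InnerProducts.
Context {R : realType}.
Implicit Types (u v : 'rV[R]_3).

Lemma dot_is_bilinear n :
  bilinear_for
    (GRing.Scale.Law.clone _ _ *:%R _) (GRing.Scale.Law.clone _ _ *:%R _)
    (@dot R n).
Proof.
split=> [y'|x'] k x y; rewrite /dot /= /GRing.scale /= mulr_sumr -big_split /=;
  by apply: eq_bigr => i _; rewrite !mxE; ring.
Qed.

HB.instance Definition _ n :=
  bilinear_isBilinear.Build R _ _ _ _ _ (@dot R n) (@dot_is_bilinear n).

Lemma dotZZ n k l (x y : 'rV[R]_n) :
  dot (k *: x) (l *: y) = k * l * dot x y.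
Proof. by rewrite /dot mulr_sumr; apply: eq_bigr => i _; rewrite !mxE; ring. Qed.

Lemma dotC n (x y : 'rV[R]_n) : dot x y = dot y x.
Proof. by apply: eq_bigr => i _; rewrite mulrC. Qed.

Lemma dot_ge0 n (x : 'rV[R]_n) : 0 <= dot x x.
Proof. by apply: sumr_ge0 => i _; rewrite -expr2 sqr_ge0. Qed.

Lemma dot_eq0 n (x : 'rV[R]_n) : dot x x = 0 -> x = 0.
Proof.
move=> /eqP; rewrite psumr_eq0 => [/allP h|i _]; last by rewrite -expr2 sqr_ge0.
apply/rowP => i; apply/eqP.
by have := h i (mem_index_enum _); rewrite -expr2 sqrf_eq0 mxE.
Qed.

Lemma conformal_free n (u v : 'rV[R]_n) (a b : R) :
  dot u u = dot v v -> dot u v = 0 -> u != 0 ->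
  a *: u + b *: v = 0 -> a = 0 /\ b = 0.
Proof.
move=> uv uv0 u0 ab0.
have N0 : dot u u != 0 by apply: contra_neq u0 => /dot_eq0.
have hu : dot u (a *: u + b *: v) = 0 by rewrite ab0 linear0r.
have hv : dot v (a *: u + b *: v) = 0 by rewrite ab0 linear0r.
move: hu hv; rewrite !linearDr !linearZr_LR /= (dotC _ v) uv0 -uv /GRing.scale /=.
rewrite !mulr0 addr0 add0r => /eqP + /eqP.
by rewrite !mulf_eq0 (negbTE N0) !orbF => /eqP -> /eqP ->.
Qed.

Lemma lagrange3 u v :
  dot (cross u v) (cross u v) = dot u u * dot v v - dot u v ^+ 2.
Proof. coords; ring. Qed.

End InnerProducts.

(** * Left trivialization of the tangent spaces of the 3-sphere *)

Section LeftTrivialization.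
Context {R : realType}.
Implicit Types (x y z p q : quat R) (u v : 'rV[R]_3).

(** At a unit quaternion [x] this is the imaginary part of the product of the
    inverse of [x] with [y]. Using the conjugate instead of the inverse makes
    the expression bilinear, so that it can be differentiated by the product
    rule. *)
Definition qlog x y : 'rV[R]_3 := qim (qmul (qconj x) y).

Definition ltrans p u : quat R := qmul p (mkquat 0 u).

Lemma qlog_is_bilinear :
  bilinear_for
    (GRing.Scale.Law.clone _ _ *:%R _) (GRing.Scale.Law.clone _ _ *:%R _) qlog.
Proof. by split=> [y'|x'] k x y /=; rewrite /qlog; coords; ring. Qed.

HB.instance Definition _ :=
  bilinear_isBilinear.Build R _ _ _ _ _ qlog qlog_is_bilinear.

Lemma qinv_unit x : dot x x = 1 -> qinv x = qconj x.
Proof. by move=> x1; rewrite /qinv x1 invr1 scale1r. Qed.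

Lemma ltransK p u : dot p p = 1 -> qlog p (ltrans p u) = u.
Proof.
by move=> p1; rewrite /qlog /ltrans qmulA qmul_conjl p1 qmul_reall scale1r qim_mkquat.
Qed.

Lemma qlogK x y : dot x x = 1 -> dot x y = 0 -> ltrans x (qlog x y) = y.
Proof.
move=> x1 xy; rewrite /ltrans (_ : mkquat 0 _ = qmul (qconj x) y); last first.
  apply: quatP; last exact: qim_mkquat.
  by rewrite qre_mkquat -xy; coords; ring.
by rewrite qmulA qmul_conjr x1 qmul_reall scale1r.
Qed.

Lemma qlog_ltrans x u v : dot x x = 1 ->
  qlog (ltrans x v) (ltrans x u) = cross u v.
Proof.
move=> x1; rewrite /qlog /ltrans.
have -> : qconj (qmul x (mkquat 0 v)) = qmul (mkquat 0 (- v)) (qconj x).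
  by coords; ring.
rewrite -qmulA (qmulA (qconj x)) qmul_conjl x1 qmul_reall scale1r.
by coords; ring.
Qed.

(** The algebra behind the Maurer-Cartan equation: [y] and [z] are the
    partial derivatives of a map into the sphere with value [x], and [w] is the
    common mixed second derivative, which cancels. *)
Lemma qlog_commutator x y z (w : quat R) :
  dot x x = 1 -> dot x y = 0 -> dot x z = 0 ->
  (qlog z y + qlog x w) - (qlog y z + qlog x w) = 2 *: cross (qlog x y) (qlog x z).
Proof.
move=> x1 xy xz; rewrite opprD addrACA subrr addr0.
rewrite -{1 2}(qlogK x y x1 xy) -{1 2}(qlogK x z x1 xz) !qlog_ltrans //.
by move: (qlog x y) (qlog x z) => u v; coords; ring.
Qed.

Lemma qmul_ltrans p q u :
  dot q q = 1 -> qmul (qmul p (qinv q)) (ltrans q u) = ltrans p u.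
Proof.
move=> q1; rewrite qinv_unit // /ltrans -qmulA; congr qmul.
by rewrite qmulA qmul_conjl q1 qmul_reall scale1r.
Qed.

Lemma dot_ltrans p u v : dot p p = 1 -> dot (ltrans p u) (ltrans p v) = dot u v.
Proof. by move=> p1; rewrite dot_qmul p1 mul1r; coords; ring. Qed.

End LeftTrivialization.

(** * The nearly Kaehler structure in left trivializations *)

Section NearlyKaehlerFrames.
Context {R : realType}.
Implicit Types (p q : quat R) (u v a b : 'rV[R]_3).
Local Notation s := (Num.sqrt 3 : R).

Lemma sqrt3_gt0 : 0 < s. Proof. by rewrite sqrtr_gt0. Qed.
Lemma sqr_sqrt3 : s * s = 3. Proof. by rewrite -expr2 sqr_sqrtr. Qed.

Lemma nkJ_ltrans p q u v : dot p p = 1 -> dot q q = 1 ->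
  nkJ p q (ltrans p u, ltrans q v) =
  (ltrans p (s^-1 *: (2 *: v - u)), ltrans q (s^-1 *: (- 2 *: u + v))).
Proof.
move=> p1 q1; rewrite /nkJ /= !qmul_ltrans //.
by congr (_, _); rewrite /ltrans; coords; ring.
Qed.

(** J-linearity in left trivializations: if the tangent vector (v, v') is J of
    (u, u'), the whole 1-jet is determined by the first factor (u, v). In
    complex terms u' - i v' = e^(i pi/3) (u - i v). *)
Lemma nkJ_frame (p q : quat R) u v u' v' : dot p p = 1 -> dot q q = 1 ->
  (ltrans p v, ltrans q v') = nkJ p q (ltrans p u, ltrans q u') ->
  u' = 2^-1 *: (u + s *: v) /\ v' = 2^-1 *: (v - s *: u).
Proof.
move=> p1 q1; rewrite nkJ_ltrans // => -[/(congr1 (qlog p)) + /(congr1 (qlog q))].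
rewrite !ltransK // => -> ->.
have s3 := sqr_sqrt3; have s0 := lt0r_neq0 sqrt3_gt0.
move: s s3 s0 => r r3 r0.
have -> : r^-1 = r / 3 by rewrite -r3 invfM mulVKf.
by split; coords; field: r3.
Qed.

Lemma nkg_ltrans p q u v u' v' : dot p p = 1 -> dot q q = 1 ->
  nkg p q (ltrans p u, ltrans q v) (ltrans p u', ltrans q v') =
  4 / 3 * (dot u u' + dot v v') - 2 / 3 * (dot u v' + dot v u').
Proof.
move=> p1 q1; rewrite /nkg !nkJ_ltrans // /prod_metric /= !dot_ltrans //.
by rewrite !dotZZ -invfM sqr_sqrt3; coords; field.
Qed.

(** With w = (a - i b) / 2, the vector Z is the pair (w, e^(i pi/3) w) in left
    trivializations, P exchanges the two entries, and the metric pairs P Z with Z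
    to (8/3) e^(i pi/3) w.w - (2/3) (1 + e^(2 i pi/3)) w.w. Since
    1 + e^(2 i pi/3) = e^(i pi/3), this is (1 + i sqrt 3) w.w. *)
Lemma nkgC_nkPC_frame p q a b : dot p p = 1 -> dot q q = 1 ->
  let a' := 2^-1 *: (a + s *: b) in
  let b' := 2^-1 *: (b - s *: a) in
  let Z := CTvec (2^-1 *: (ltrans p a, ltrans q a'))
                 (- 2^-1 *: (ltrans p b, ltrans q b')) in
  nkgC p q (nkPC p q Z) Z =
  Complex ((dot a a - dot b b + 2 * s * dot a b) / 4)
          ((s * (dot a a - dot b b) - 2 * dot a b) / 4).
Proof.
move=> p1 q1 a' b' Z.
have ltransZ k x u : ltrans x (k *: u) = k *: ltrans x u.
  by rewrite /ltrans; coords; ring.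
have pairZ k x y : k *: (x, y) = (k *: x, k *: y) :> quat R * quat R by [].
rewrite /nkgC /nkPC /Z /= !pairZ -!ltransZ /nkP /= !qmul_ltrans // !nkg_ltrans //.
rewrite /a' /b'; have := sqr_sqrt3; move: s => r rr.
have {rr} e : r * r = 3 by [].
by congr Complex; coords; field: e.
Qed.

End NearlyKaehlerFrames.

(** * The rotation by the angle 2 pi/3 *)

Section RotatedFrame.
Context {R : realType}.
Local Notation s := (Num.sqrt 3 : R).

(** Purely algebraic heart of the constant mean curvature equation. The vectors
    [x00], [x01], [x10], [x11] stand for the derivatives of the frame (u, v): the
    second index names the vector, the first the direction. The divergence of the
    rotated frame combines the divergence and the curl of the frame, which
    contribute -1/sqrt 3 and - sqrt 3 times the cross product; the cross product
    itself is invariant under the rotation. *)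
Lemma rotated_laplacian (x00 x01 x10 x11 u v : 'rV[R]_3) :
  x10 - x01 = 2 *: cross u v -> x00 + x11 = (2 / s) *: cross u v ->
  (- 2^-1 *: x00 + (s / 2) *: x01) + (- (s / 2) *: x10 + (- 2^-1) *: x11) =
  (2 * (- 2 / s)) *: cross (- 2^-1 *: u + (s / 2) *: v) (- (s / 2) *: u + (- 2^-1) *: v).
Proof.
move=> mc dv.
have s3 := @sqr_sqrt3 R; have s0 := lt0r_neq0 (@sqrt3_gt0 R).
have -> : - 2^-1 *: x00 + (s / 2) *: x01 + (- (s / 2) *: x10 + (- 2^-1) *: x11) =
    - 2^-1 *: (x00 + x11) - (s / 2) *: (x10 - x01) by coords; ring.
rewrite mc dv; move: s s3 s0 => r r3 r0.
have -> : r^-1 = r / 3 by rewrite -r3 invfM mulVKf.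
by coords; field: r3.
Qed.

Lemma rotated_frame_eq0 (u v : 'rV[R]_3) :
  - 2^-1 *: u + (s / 2) *: v = 0 -> - (s / 2) *: u + (- 2^-1) *: v = 0 ->
  u = 0 /\ v = 0.
Proof.
have s3 := @sqr_sqrt3 R; move: s s3 => r r3 u0 v0.
split.
  have -> : u = - 2^-1 *: (- 2^-1 *: u + (r / 2) *: v)
     - (r / 2) *: (- (r / 2) *: u + (- 2^-1) *: v) by coords; field: r3.
  by rewrite u0 v0 !scaler0 subr0.
have -> : v = (r / 2) *: (- 2^-1 *: u + (r / 2) *: v)
   - 2^-1 *: (- (r / 2) *: u + (- 2^-1) *: v) by coords; field: r3.
by rewrite u0 v0 !scaler0 subr0.
Qed.

Lemma Complex_conformal_eq0 (x y z : R) :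
  (x = y /\ z = 0) <-> Complex (- (x - y) / 2) z = 0.
Proof.
split=> [[-> ->]|[xy ->]]; first by rewrite subrr oppr0 mul0r.
by split=> //; lra.
Qed.

End RotatedFrame.

Section Trigonometry.
Context {R : realType}.

Lemma cos_theta : cos (theta R) = - 2^-1.
Proof.
have pi0 := @pi_gt0 R.
have tE : theta R = pi - pi / 3 by rewrite /theta; field.
have c0 : 0 < cos (pi / 3 : R) by apply: cos_gt0_pihalf; apply/andP; split; lra.
have : cos (pi : R) = -1 by exact: cospi.
have -> : (pi : R) = pi / 3 *+ 2 + pi / 3 by rewrite mulr2n; field.
(* The triple angle formula at pi/3 gives (x + 1) (2 x - 1)^2 = 0 for the
   cosine x of pi/3, and x > 0 excludes the root -1. *)
rewrite cosD cos_mulr2n sin_mulr2n.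
have := cos2Dsin2 (pi / 3 : R).
rewrite tE cosB cospi sinpi mul0r addr0 mulN1r.
move: c0; move: (cos _) (sin _) => x y x0 xy e; congr (- _).
have {}e : (x + 1) * (2 * x - 1) ^+ 2 = 0.
  have yy : y ^+ 2 = 1 - x ^+ 2 by lra.
  have -> : (x + 1) * (2 * x - 1) ^+ 2 =
    (x ^+ 2 *+ 2 - 1) * x - 2 * x * (1 - x ^+ 2) + 1 by rewrite mulr2n; ring.
  by rewrite -yy -[in RHS](subrr (-1)) -[in X in _ = X - _]e opprK !mulr2n; ring.
move/eqP: e; rewrite mulf_eq0 expf_eq0 /= => /orP[/eqP|/eqP] h; lra.
Qed.

Lemma sin_theta : sin (theta R) = Num.sqrt 3 / 2.
Proof.
have pi0 := @pi_gt0 R.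
have s0 : 0 <= sin (theta R).
  by apply: sin_ge0_pi; rewrite /theta; apply/andP; split; lra.
rewrite -[LHS](ger0_norm s0) -sqrtr_sqr sin2cos2 cos_theta.
have -> : 1 - (- 2^-1) ^+ 2 = 3 * (2^-1) ^+ 2 :> R by field.
by rewrite sqrtrM // sqrtr_sqr ger0_norm.
Qed.

End Trigonometry.

(** * Directional derivatives: mean value theorem and symmetry *)

Section DirectionalCalculus.
Context {R : realType} {V : normedModType R}.
Implicit Types (f : V -> R) (a u v : V).

Lemma is_derive_line f a v t : derivable f (t *: v + a) v ->
  is_derive t 1 (fun s : R => f (s *: v + a)) ('D_v f (t *: v + a)).
Proof.
have E : (fun h : R => h^-1 *: (((fun s : R => f (s *: v + a)) \o shift t) (h *: 1)
            - f (t *: v + a))) =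
         (fun h : R => h^-1 *: ((f \o shift (t *: v + a)) (h *: v) - f (t *: v + a))).
  by apply/funext => h /=; rewrite addrA -scalerDl [h *: 1]mulr1.
by move=> df; apply: DeriveDef; rewrite /derivable /derive E.
Qed.

(** Mean value theorem along the line through [a] directed by [v], for a step [h]
    of either sign. *)
Lemma MVT_line f a v (h : R) :
  (forall t : R, `|t| <= `|h| -> derivable f (t *: v + a) v) ->
  exists2 t : R, `|t| <= `|h| & f (h *: v + a) - f a = h * 'D_v f (t *: v + a).
Proof.
move=> df; pose g (s : R) := f (s *: v + a).
have dg (t : R) : `|t| <= `|h| -> is_derive t 1 g ('D_v f (t *: v + a)).
  by move=> th; apply: is_derive_line; apply: df.
have cg (x y : R) : (forall t, t \in `[x, y] -> `|t| <= `|h|) ->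
    {within `[x, y], continuous g}.
  move=> xy; apply: derivable_within_continuous => t /xy th.
  by have := dg t th; case.
have g0 : f a = g 0 by rewrite /g scale0r add0r.
rewrite g0 -[f (h *: v + a)]/(g h).
have [h0|h0] := leP 0 h.
  have bnd t : t \in `[0, h] -> `|t| <= `|h|.
    by rewrite in_itv /= => /andP[t0 th]; rewrite !ger0_norm.
  have [t t0h ->] := MVT_segment h0 (fun t ht => dg t (bnd t (subset_itv_oo_cc ht)))
    (cg _ _ bnd).
  by exists t; [exact: bnd|rewrite subr0 mulrC].
have bnd t : t \in `[h, 0] -> `|t| <= `|h|.
  by rewrite in_itv /= => /andP[th t0]; rewrite !ler0_norm ?lerN2 // ltW.
have [t th0 e] := MVT_segment (ltW h0) (fun t ht => dg t (bnd t (subset_itv_oo_cc ht)))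
  (cg _ _ bnd).
by exists t; [exact: bnd|rewrite -opprB e sub0r mulrN opprK mulrC].
Qed.

Lemma near_parallelogram (P : set V) a u v : nbhs a P ->
  exists2 h : R, 0 < h &
    forall s t : R, `|s| <= h -> `|t| <= h -> P (s *: u + (t *: v + a)).
Proof.
move=> /nbhs_ballP[e /= e0 eP].
pose K := `|u| + `|v| + 1; have K0 : 0 < K by rewrite ltr_wpDl ?addr_ge0.
exists (e / K / 2); first by rewrite !divr_gt0.
move=> s t hs ht; apply: eP; rewrite -ball_normE /= addrA opprD addrCA subrr addr0.
rewrite normrN (le_lt_trans (ler_normD _ _)) // !normrZ.
apply: (@le_lt_trans _ _ (e / K / 2 * K)).
  rewrite /K mulrDr mulrDr -[leLHS]addr0 lerD //.
    by rewrite lerD // ler_wpM2r.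
  by rewrite mulr1 ltW // !divr_gt0.
by rewrite mulrAC divfK ?gt_eqF // ltr_pdivrMr // mulr_natr mulr2n ltrDl.
Qed.

(** Two applications of the mean value theorem: the increment in direction [v] is
    itself a function to which the theorem applies in direction [u]. The left-hand
    side is symmetric in [u] and [v], which is what makes mixed derivatives
    commute. *)
Lemma second_difference f a u v (h : R) :
  (forall s t : R, `|s| <= `|h| -> `|t| <= `|h| ->
     derivable f (s *: u + (t *: v + a)) u /\
     derivable ('D_u f) (s *: u + (t *: v + a)) v) ->
  exists s t : R, [/\ `|s| <= `|h|, `|t| <= `|h| &
    (f (h *: u + (h *: v + a)) - f (h *: u + a)) - (f (h *: v + a) - f a) =
    h * (h * 'D_v ('D_u f) (s *: u + (t *: v + a)))].
Proof.
move=> df; pose g x := f (h *: v + x) - f x.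
have h00 : `|0 : R| <= `|h| by rewrite normr0.
have dfu s t : `|s| <= `|h| -> `|t| <= `|h| -> derivable f (s *: u + (t *: v + a)) u.
  by move=> hs ht; exact: (proj1 (df s t hs ht)).
have shiftd x : derivable f (h *: v + x) u ->
    is_derive x u (fun x => f (h *: v + x)) ('D_u f (h *: v + x)).
  have E : (fun k : R => k^-1 *: (((fun x => f (h *: v + x)) \o shift x) (k *: u)
            - f (h *: v + x))) =
           (fun k : R => k^-1 *: ((f \o shift (h *: v + x)) (k *: u) - f (h *: v + x))).
    by apply/funext => k /=; rewrite addrCA.
  by move=> dx; apply: DeriveDef; rewrite /derivable /derive E.
have dg s : `|s| <= `|h| -> is_derive (s *: u + a) u g
    ('D_u f (h *: v + (s *: u + a)) - 'D_u f (s *: u + a)).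
  move=> hs; apply: is_deriveB.
    by apply: shiftd; rewrite addrCA; exact: dfu.
  by apply: derivableP; have := dfu s 0 hs h00; rewrite scale0r add0r.
have [|s hs e1] := @MVT_line g a u h; first by move=> s /dg; case.
have [|t ht e2] := @MVT_line ('D_u f) (s *: u + a) v h.
  by move=> t ht; rewrite addrCA; case: (df s t hs ht).
exists s, t; split=> //; move: e1; rewrite (derive_val (is_derive := dg s hs)) e2.
by rewrite /g !(addrCA (h *: v)) (addrCA (t *: v)).
Qed.

(** Both mixed derivatives take a common value, the second difference divided by
    [h ^+ 2], at points of an arbitrarily small parallelogram around [a]; by
    continuity they agree at [a]. *)
Lemma derive_comm f a u v :
  (\forall x \near a, [/\ derivable f x u, derivable f x v,
     derivable ('D_u f) x v & derivable ('D_v f) x u]) ->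
  {for a, continuous ('D_v ('D_u f))} -> {for a, continuous ('D_u ('D_v f))} ->
  'D_v ('D_u f) a = 'D_u ('D_v f) a.
Proof.
move=> nd /cvgrPdist_lt cvu /cvgrPdist_lt cuv.
apply/eqP; rewrite -subr_eq0 -normr_le0; apply/ler_addgt0Pl => e e0; rewrite addr0.
have e20 : 0 < e / 2 by rewrite divr_gt0.
have [h h0 hP] := near_parallelogram _ _ u v (filterI nd (filterI (cvu _ e20) (cuv _ e20))).
have hh : `|h| = h by rewrite gtr0_norm.
have [|s [t [hs ht E]]] := @second_difference f a u v h.
  by rewrite hh => s t hs ht; case: (hP s t hs ht) => -[].
have [|t' [s' [ht' hs' E']]] := @second_difference f a v u h.
  by rewrite hh => y x hy hx; rewrite addrCA; case: (hP x y hx hy) => -[_ dv _ duv] _; exact: (conj dv duv).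
move: hs ht hs' ht'; rewrite hh => hs ht hs' ht'.
have [_ [Fs _]] := hP s t hs ht; have [_ [_ Gs]] := hP s' t' hs' ht'.
move: Fs Gs; rewrite /= (addrCA (s' *: u)).
set X := 'D_v _ (_ + _) in E *; set Y := 'D_u _ (_ + _) in E' *.
have fE : f (h *: v + (h *: u + a)) = f (h *: u + (h *: v + a)) by rewrite addrCA.
rewrite fE in E'; clearbody X Y.
have -> : X = Y.
  apply: (mulfI (lt0r_neq0 h0)); apply: (mulfI (lt0r_neq0 h0)).
  have swap (x y z w : R) : x - y - (z - w) = x - z - (y - w) by ring.
  by rewrite -E -E' swap.
move: ('D_v _ a) ('D_u _ a) => A B Fs Gs; rewrite -(subrKA Y) (le_trans (ler_normD _ _)) //.
by rewrite (distrC Y B) (splitr e) lerD // ltW.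
Qed.

End DirectionalCalculus.

(** * Functions of two variables with continuous partial derivatives *)

Section PlaneCalculus.
Context {R : realType}.
Local Notation e0 := (delta_mx 0 0 : 'rV[R]_2).
Local Notation e1 := (delta_mx 0 1 : 'rV[R]_2).

Lemma plane_decomp (x : 'rV[R]_2) : x = x 0 0 *: e0 + x 0 1 *: e1.
Proof.
rewrite {1}(row_sum_delta x) !big_ord_recl big_ord0 addr0.
by congr (_ *: delta_mx _ _ + _ *: delta_mx _ _); try congr (x _ _); apply: val_inj.
Qed.

Lemma coord_le_norm n (x : 'rV[R]_n) i : `|x 0 i| <= `|x|.
Proof.
by rewrite [leRHS]/Num.Def.normr /= mx_normrE; apply: (le_bigmax _ _ (0, i)).
Qed.

Lemma continuous_coords (T : topologicalType) n (f : T -> 'rV[R]_n) a :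
  (forall i, {for a, continuous (fun x => f x 0 i)}) -> {for a, continuous f}.
Proof.
move=> cf; apply/cvgrPdist_le => /= e eps0; near=> x.
rewrite [leLHS]/Num.Def.normr /= mx_normrE (bigmax_le _ (ltW eps0)) //= => -[k i] _.
rewrite !mxE /= (ord1 k); move: i; near: x; apply: filter_forall => /= i.
exact: ((cvgrPdist_le _ _).1 (cf i)).
Unshelve. all: by end_near. Qed.

(** Going from [a] to a nearby point parallel to the axes, the mean value theorem
    bounds the increment by the distance times a bound [K] on the partial
    derivatives near [a]. *)
Lemma continuous_of_partials (f : 'rV[R]_2 -> R) (a : 'rV[R]_2) :
  (\forall x \near a, derivable f x e0 /\ derivable f x e1) ->
  {for a, continuous ('D_e0 f)} -> {for a, continuous ('D_e1 f)} ->
  {for a, continuous f}.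
Proof.
move=> nd c0 c1.
pose K := `|'D_e0 f a| + `|'D_e1 f a| + 1.
have K0 : 0 < K by rewrite ltr_wpDl ?addr_ge0.
have bnd (g : 'rV[R]_2 -> R) : {for a, continuous g} ->
    \forall x \near a, `|g x| <= `|g a| + 1.
  move=> /cvgrPdist_lt /(_ 1 ltr01); apply: filterS => x /ltW h.
  by rewrite -lerBlDl (le_trans (lerB_dist _ _)) // distrC.
have [h h0 hP] := near_parallelogram _ _ e0 e1 (filterI nd (filterI (bnd _ c0) (bnd _ c1))).
have FF : Filter (nbhs a) := nbhs_filter a.
apply: (proj2 (@cvgrPdist_le R R _ (nbhs a) FF f (f a))) => e eps0.
have d0 : 0 < Num.min h (e / K / 2) by rewrite lt_min h0 !divr_gt0.
apply: filterS (nbhsx_ballx a _ d0) => y; rewrite -ball_normE /= distrC lt_min.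
move=> /andP[/ltW yh /ltW ye].
pose s : R := (y - a) 0 0; pose t : R := (y - a) 0 1.
have ya : y = s *: e0 + (t *: e1 + a) by rewrite addrA -plane_decomp subrK.
have hs : `|s| <= h by rewrite (le_trans (coord_le_norm _ _ _)) //.
have ht : `|t| <= h by rewrite (le_trans (coord_le_norm _ _ _)) //.
have z0 : `|0 : R| <= h by rewrite normr0 ltW.
have [|x hx E] := @MVT_line R _ f (t *: e1 + a) e0 s.
  move=> x hx; exact: (proj1 (proj1 (hP x t (le_trans hx hs) ht))).
have [|x' hx' E'] := @MVT_line R _ f a e1 t.
  move=> x' hx'; case: (hP 0 x' z0 (le_trans hx' ht)) => -[].
  by rewrite scale0r add0r.
have [_ [B _]] := hP x t (le_trans hx hs) ht.
have [_ [_ B']] := hP 0 x' z0 (le_trans hx' ht).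
move: B'; rewrite scale0r add0r => B'.
rewrite distrC -(subrKA (f (t *: e1 + a))) {1}ya E E'.
rewrite (le_trans (ler_normD _ _)) // !normrM.
have le1 (r d : R) : `|r| <= e / K / 2 -> `|d| <= K -> `|r| * `|d| <= e / 2.
  move=> h1 h2; rewrite (le_trans (ler_pM _ _ h1 h2)) //.
  by rewrite mulrAC divfK ?gt_eqF.
rewrite (splitr e) lerD //; apply: le1 => //.
- by rewrite (le_trans (coord_le_norm _ _ _)) //.
- by rewrite (le_trans B) // /K -addrA [leRHS]addrCA lerDr.
- by rewrite (le_trans (coord_le_norm _ _ _)) //.
- by rewrite (le_trans B') // /K -addrA lerDr.
Qed.
End PlaneCalculus.

(** * Product rule and smoothness for bilinear maps *)

Section BilinearCalculus.
Context {R : realType}.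

Lemma bilin_continuous m n (W : normedModType R)
    (B : {bilinear 'rV[R]_m -> 'rV[R]_n -> W}) :
  continuous (fun p : 'rV[R]_m * 'rV[R]_n => B p.1 p.2).
Proof.
have -> : (fun p : 'rV[R]_m * 'rV[R]_n => B p.1 p.2) =
    (fun p => \sum_i \sum_j (p.1 0 i * p.2 0 j) *: B (delta_mx 0 i) (delta_mx 0 j)).
  apply/funext => -[x y] /=.
  rewrite {1}(row_sum_delta x) linear_sumlz; apply: eq_bigr => i _.
  rewrite linearZl_LR /= {1}(row_sum_delta y) linear_sumr scaler_sumr.
  by apply: eq_bigr => j _; rewrite linearZr_LR /= scalerA.
move=> p; apply: cvg_big => [|i _]; first exact: add_continuous.
apply: cvg_big => [|j _]; first exact: add_continuous.
apply: cvgZr_tmp; apply: cvgM.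
  by apply: (@continuous_comp _ _ _ fst (fun x : 'rV[R]_m => x 0 i));
    [exact: cvg_fst|exact: coord_continuous].
by apply: (@continuous_comp _ _ _ snd (fun y : 'rV[R]_n => y 0 j));
  [exact: cvg_snd|exact: coord_continuous].
Qed.

Lemma is_derive_bilin m n (V W : normedModType R)
    (B : {bilinear 'rV[R]_m -> 'rV[R]_n -> W})
    (f : V -> 'rV[R]_m) (g : V -> 'rV[R]_n) (a v : V) df dg :
  is_derive a v f df -> is_derive a v g dg ->
  is_derive a v (fun x => B (f x) (g x)) (B df (g a) + B (f a) dg).
Proof.
move=> [f' <-] [g' <-].
have lim : (fun h => h^-1 *: (((fun x => B (f x) (g x)) \o shift a) (h *: v)
      - B (f a) (g a))) @ 0^' --> B ('D_v f a) (g a) + B (f a) ('D_v g a).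
  have -> : (fun h => h^-1 *: (((fun x => B (f x) (g x)) \o shift a) (h *: v)
      - B (f a) (g a))) =
     (fun h => B (h^-1 *: ((f \o shift a) (h *: v) - f a)) (g a) +
       B (f (h *: v + a)) (h^-1 *: ((g \o shift a) (h *: v) - g a))).
    apply/funext => h /=; rewrite linearZl_LR linearZr_LR /= -scalerDr; congr (_ *: _).
    by rewrite linearBl linearBr [RHS]addrC subrKA.
  have cB x y : B p.1 p.2 @[p --> (x, y)] --> B x y by exact: (bilin_continuous _ _ _ B (x, y)).
  apply: cvgD.
    by apply: (cvg_comp2 f' (cvg_cst _) (cB _ _)).
  apply: (cvg_comp2 _ g' (cB _ _)).
  suff : {for 0, continuous (fun h : R => f (h *: v + a))}.
    by move=> /continuous_withinNx; rewrite scale0r add0r.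
  exact/differentiable_continuous/derivable1_diffP/(derivable1P _ _ _).1.
apply: DeriveDef; first by apply/cvg_ex; eexists; exact: lim.
exact: cvg_lim lim.
Qed.

End BilinearCalculus.

Section SmoothMaps.
Context {R : realType}.
Implicit Types (W : normedModType R) (A : set 'rV[R]_2).

Lemma near_open (T : topologicalType) (A : set T) (P : T -> Prop) a :
  open A -> a \in A -> {in A, forall x, P x} -> \forall x \near a, P x.
Proof.
move=> oA /set_mem aA AP; apply: filterS (open_nbhs_nbhs (conj oA aA)).
by move=> x xA; apply: AP; rewrite inE.
Qed.

Lemma eq_Ck_on W A (f g : 'rV[R]_2 -> W) k :
  open A -> {in A, f =1 g} -> Ck_on k A f -> Ck_on k A g.
Proof.
move=> oA; elim: k f g => [|k IH] f g fg [cf df].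
all: have fgn a : a \in A -> \forall x \near a, f x = g x by move=> aA; exact: near_open fg.
all: split; first (move=> a aA; rewrite /continuous_at -fg //;
  exact: cvg_trans (near_eq_cvg (fgn a aA)) (cf a aA)).
  by [].
move=> i; case: (df i) => dfi Ck; split=> [a aA|].
  exact: near_eq_derivable (fgn a aA) (dfi a aA).
by apply: IH Ck => a aA; exact: near_eq_derive (fgn a aA).
Qed.

Lemma Ck_onW W A (f : 'rV[R]_2 -> W) k : Ck_on k.+1 A f -> Ck_on k A f.
Proof.
elim: k f => [|k IH] f [cf df]; first by split.
by split=> // i; case: (df i) => dfi /IH.
Qed.

Lemma Ck_onD W A (f g : 'rV[R]_2 -> W) k : open A ->
  Ck_on k A f -> Ck_on k A g -> Ck_on k A (fun x => f x + g x).
Proof.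
move=> oA; elim: k f g => [|k IH] f g [cf df] [cg dg].
all: split; first by move=> a aA; exact: (cvgD (cf a aA) (cg a aA)).
  by [].
move=> i; case: (df i) (dg i) => dfi Cf [dgi Cg]; split=> [a aA|].
  by apply: derivableD; [exact: (dfi a aA)|exact: (dgi a aA)].
apply: (eq_Ck_on _ _ _ _ _ oA _ (IH _ _ Cf Cg)) => a aA.
by rewrite /= deriveD //; [exact: (dfi a aA)|exact: (dgi a aA)].
Qed.

Lemma Ck_onZ W A (f : 'rV[R]_2 -> W) (r : R) k : open A ->
  Ck_on k A f -> Ck_on k A (fun x => r *: f x).
Proof.
move=> oA; elim: k f => [|k IH] f [cf df].
all: split; first by move=> a aA; exact: (cvgZ (cvg_cst r) (cf a aA)).
  by [].
move=> i; case: (df i) => dfi Cf; split=> [a aA|].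
  by apply: derivableZ; exact: (dfi a aA).
apply: (eq_Ck_on _ _ _ _ _ oA _ (IH _ Cf)) => a aA.
by rewrite /= deriveZ //; exact: (dfi a aA).
Qed.

Lemma Ck_on_bilin m n W A (B : {bilinear 'rV[R]_m -> 'rV[R]_n -> W}) f g k :
  open A -> Ck_on k A f -> Ck_on k A g -> Ck_on k A (fun x => B (f x) (g x)).
Proof.
move=> oA; elim: k f g => [|k IH] f g Cf Cg; have [cf df] := Cf; have [cg dg] := Cg.
all: split; first by move=> a aA;
  apply: (cvg_comp2 (cf a aA) (cg a aA) (bilin_continuous _ _ _ B (_, _))).
  by [].
move=> i; have [dfi Cfi] := df i; have [dgi Cgi] := dg i.
have D a : a \in A -> is_derive a (delta_mx 0 i) (fun x => B (f x) (g x))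
    (B ('D_(delta_mx 0 i) f a) (g a) + B (f a) ('D_(delta_mx 0 i) g a)).
  by move=> aA; apply: is_derive_bilin; apply: derivableP; [exact: (dfi a aA)|exact: (dgi a aA)].
split=> [a /D[]//|].
apply: (eq_Ck_on _ _ _ _ _ oA _ (Ck_onD _ _ _ _ _ oA (IH _ _ Cfi (Ck_onW _ _ _ _ Cg))
  (IH _ _ (Ck_onW _ _ _ _ Cf) Cgi))) => a aA.
by rewrite (derive_val (is_derive := D a aA)).
Qed.

Lemma smooth_on_D W A (f : 'rV[R]_2 -> W) i :
  smooth_on A f -> smooth_on A ('D_(delta_mx 0 i) f).
Proof. by move=> sf k; case: (sf k.+1) => _ /(_ i)[]. Qed.

Lemma smooth_on_continuous W A (f : 'rV[R]_2 -> W) :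
  smooth_on A f -> {in A, continuous f}.
Proof. by move=> /(_ 0)[]. Qed.

Lemma smooth_on_derivable W A (f : 'rV[R]_2 -> W) i :
  smooth_on A f -> {in A, forall a, derivable f a (delta_mx 0 i)}.
Proof. by move=> /(_ 1)[_ /(_ i)[]]. Qed.

End SmoothMaps.

(** * Smooth vector-valued functions on the plane *)

Section SmoothPlane.
Context {R : realType}.
Implicit Types (A : set 'rV[R]_2).
Local Notation e_ i := (delta_mx 0 i : 'rV[R]_2).

Lemma derive_coord n (V : normedModType R) (f : V -> 'rV[R]_n) a v j :
  derivable f a v -> 'D_v (fun x => f x 0 j) a = ('D_v f a) 0 j.
Proof. by move=> df; rewrite derive_mx // mxE. Qed.

Lemma Ck_on_coord n A (f : 'rV[R]_2 -> 'rV[R]_n) j k :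
  open A -> Ck_on k A f -> Ck_on k A (fun x => f x 0 j).
Proof.
move=> oA; elim: k f => [|k IH] f [cf df].
all: split; first by move=> a aA; apply: (@continuous_comp _ _ _ f
    (fun y : 'rV[R]_n => y 0 j)); [exact: (cf a aA)|exact: coord_continuous].
  by [].
move=> i; case: (df i) => dfi Cf; split=> [a aA|].
  exact: (proj1 (derivable_mxP _ _ _) (dfi a aA)).
apply: (eq_Ck_on _ _ _ _ _ oA _ (IH _ Cf)) => a aA.
by rewrite derive_coord //; exact: (dfi a aA).
Qed.

Lemma smooth_derive_comm n A (f : 'rV[R]_2 -> 'rV[R]_n) i j a :
  open A -> smooth_on A f -> a \in A ->
  'D_(e_ i) ('D_(e_ j) f) a = 'D_(e_ j) ('D_(e_ i) f) a.
Proof.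
move=> oA sf aA; apply/rowP => k.
pose g x := f x 0 k.
have sg : smooth_on A g by move=> l; exact: Ck_on_coord.
have gE i' j' : ('D_(e_ i') ('D_(e_ j') f) a) 0 k = 'D_(e_ i') ('D_(e_ j') g) a.
  rewrite -derive_coord; last exact: smooth_on_derivable (smooth_on_D _ _ _ _ sf) _ aA.
  apply: near_eq_derive; apply: (near_open _ _ _ _ oA aA) => x xA.
  by rewrite derive_coord //; exact: smooth_on_derivable sf _ xA.
apply: (etrans (gE i j)); apply: (etrans _ (esym (gE j i))); apply: derive_comm.
- apply: (near_open _ _ _ _ oA aA) => x xA.
  have sD i' : smooth_on A ('D_(e_ i') g) by exact: smooth_on_D.
  by split; [exact: smooth_on_derivable sg _ xA|exact: smooth_on_derivable sg _ xA|
    exact: smooth_on_derivable (sD _) _ xA|exact: smooth_on_derivable (sD _) _ xA].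
- exact: smooth_on_continuous (smooth_on_D _ _ _ _ (smooth_on_D _ _ _ _ sg)) _ aA.
- exact: smooth_on_continuous (smooth_on_D _ _ _ _ (smooth_on_D _ _ _ _ sg)) _ aA.
Qed.

(** Continuity is the only point that is not immediate, since the existence of
    partial derivatives alone does not imply it. *)
Lemma smooth_on_of_partials n A (f : 'rV[R]_2 -> 'rV[R]_n) (g : 'I_2 -> 'rV[R]_2 -> 'rV[R]_n) :
  open A -> (forall i, smooth_on A (g i)) ->
  (forall i, {in A, forall a, is_derive a (e_ i) f (g i a)}) ->
  smooth_on A f.
Proof.
move=> oA sg dg.
have dfi i : {in A, forall a, derivable f a (e_ i)} by move=> a /(dg i)[].
have Dfi i : {in A, g i =1 'D_(e_ i) f} by move=> a aA; case: (dg i a aA) => _ ->.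
have cf : {in A, continuous f}.
  move=> a aA; apply: continuous_coords => j.
  have cD i : {for a, continuous ('D_(e_ i) (fun x => f x 0 j))}.
    have /smooth_on_continuous : smooth_on A ('D_(e_ i) (fun x => f x 0 j)).
      move=> k; apply: (eq_Ck_on _ _ _ _ _ oA _ (Ck_on_coord _ _ _ j _ oA (sg i k))) => x xA.
      by rewrite derive_coord; [rewrite Dfi|exact: dfi].
    by apply.
  apply: continuous_of_partials (cD 0) (cD 1).
  apply: (near_open _ _ _ _ oA aA) => x xA.
  by split; apply: (proj1 (derivable_mxP _ _ _)); exact: (dfi _ x xA).
case=> [|k]; split=> // i; split; first exact: dfi.
exact: (eq_Ck_on _ _ _ _ _ oA (Dfi i) (sg i k)).
Qed.

End SmoothPlane.

(** * Logarithmic derivatives and the Maurer-Cartan equation *)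

Section LogarithmicDerivatives.
Context {R : realType}.
Variable A : set 'rV[R]_2.
Hypothesis oA : open A.
Implicit Types (P Q : 'rV[R]_2 -> quat R).
Local Notation e_ i := (delta_mx 0 i : 'rV[R]_2).

Definition logd P (i : 'I_2) (a : 'rV[R]_2) : 'rV[R]_3 :=
  qlog (P a) ('D_(e_ i) P a).

Lemma smooth_logd P i : smooth_on A P -> smooth_on A (logd P i).
Proof.
by move=> sP k; apply: (Ck_on_bilin _ _ _ _ qlog) => //; exact: smooth_on_D.
Qed.

Lemma sphere_orth P i a : smooth_on A P -> {in A, forall x, dot (P x) (P x) = 1} ->
  a \in A -> dot (P a) ('D_(e_ i) P a) = 0.
Proof.
move=> sP P1 aA.
have dP : is_derive a (e_ i) P ('D_(e_ i) P a).
  by apply: derivableP; exact: smooth_on_derivable sP _ aA.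
have d1 := is_derive_bilin _ _ _ _ (@dot R (1 + 3)) _ _ _ _ _ _ dP dP.
have : is_derive a (e_ i) (fun x => dot (P x) (P x)) 0.
  apply: (@near_eq_is_derive R _ R (cst 1) _ a (e_ i) 0).
  by apply: (near_open _ _ _ _ oA aA) => x /P1 ->.
have [_ E1] := d1; move=> [_]; rewrite E1 /= dotC -mulr2n => /eqP.
by rewrite mulrn_eq0 => /eqP.
Qed.

Lemma ltrans_logd P i a : smooth_on A P -> {in A, forall x, dot (P x) (P x) = 1} ->
  a \in A -> ltrans (P a) (logd P i a) = 'D_(e_ i) P a.
Proof. by move=> sP P1 aA; rewrite qlogK ?P1 //; exact: sphere_orth. Qed.

Lemma derive_logd P i j a : smooth_on A P -> a \in A ->
  'D_(e_ j) (logd P i) a =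
  qlog ('D_(e_ j) P a) ('D_(e_ i) P a) + qlog (P a) ('D_(e_ j) ('D_(e_ i) P) a).
Proof.
move=> sP aA; rewrite /logd.
have dP : is_derive a (e_ j) P ('D_(e_ j) P a).
  by apply: derivableP; exact: smooth_on_derivable sP _ aA.
have dDP : is_derive a (e_ j) ('D_(e_ i) P) ('D_(e_ j) ('D_(e_ i) P) a).
  by apply: derivableP; exact: smooth_on_derivable (smooth_on_D _ _ _ _ sP) _ aA.
by have [_ ->] := is_derive_bilin _ _ _ _ qlog _ _ _ _ _ _ dP dDP.
Qed.

(** Flatness of the left-invariant form on the 3-sphere. The second derivatives
    of [P] cancel by symmetry; what remains is the commutator of imaginary
    quaternions, which is twice the cross product. *)
Lemma maurer_cartan P i j a : smooth_on A P -> {in A, forall x, dot (P x) (P x) = 1} ->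
  a \in A ->
  'D_(e_ j) (logd P i) a - 'D_(e_ i) (logd P j) a =
  2 *: cross (logd P i a) (logd P j a).
Proof.
move=> sP P1 aA.
have C : 'D_(e_ j) ('D_(e_ i) P) a = 'D_(e_ i) ('D_(e_ j) P) a.
  exact: smooth_derive_comm oA sP aA.
have Ei := etrans (derive_logd P i j a sP aA)
  (congr1 (fun x => qlog ('D_(e_ j) P a) ('D_(e_ i) P a) + qlog (P a) x) C).
have Ej := derive_logd P j i a sP aA.
apply: (etrans (congr2 (fun x y : 'rV[R]_3 => x - y) Ei Ej)).
apply: qlog_commutator; [exact: P1|exact: sphere_orth|exact: sphere_orth].
Qed.

End LogarithmicDerivatives.

(** * J-holomorphicity as a divergence equation *)

Section NearlyKaehlerSurface.
Context {R : realType}.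
Local Notation s := (Num.sqrt 3 : R).
Local Notation e_ i := (delta_mx 0 i : 'rV[R]_2).

(** The two hypotheses are the Maurer-Cartan equations of the two factors, the
    second one written in terms of the frame (u, v) of the first factor. The curl
    terms account for half of the second equation, and the other half is a
    divergence. *)
Lemma frame_divergence (xii xij xji xjj u v : 'rV[R]_3) :
  xji - xij = 2 *: cross u v ->
  2^-1 *: (xji + s *: xjj) - 2^-1 *: (xij - s *: xii) =
    2 *: cross (2^-1 *: (u + s *: v)) (2^-1 *: (v - s *: u)) ->
  xii + xjj = (2 / s) *: cross u v.
Proof.
have s0 := lt0r_neq0 (@sqrt3_gt0 R).
have -> : cross (2^-1 *: (u + s *: v)) (2^-1 *: (v - s *: u)) = cross u v.
  have s3 := @sqr_sqrt3 R; move: s s3 {s0} => r r3.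
  by coords; field: r3.
move=> h1 h2.
have {}h2 : s *: (xii + xjj) = 2 *: cross u v.
  apply: (@scalerI _ _ 2^-1); first by rewrite invr_eq0.
  have -> : 2^-1 *: (s *: (xii + xjj)) =
      (2^-1 *: (xji + s *: xjj) - 2^-1 *: (xij - s *: xii)) - 2^-1 *: (xji - xij).
    by coords; ring.
  by rewrite h1 h2; coords; field.
by rewrite mulrC -scalerA -h2 scalerA mulVf // scale1r.
Qed.

Variables (A : set 'rV[R]_2) (P Q : 'rV[R]_2 -> quat R) (i j : 'I_2).
Hypotheses (oA : open A) (sP : smooth_on A P) (sQ : smooth_on A Q).
Hypotheses (P1 : {in A, forall x, dot (P x) (P x) = 1})
           (Q1 : {in A, forall x, dot (Q x) (Q x) = 1}).
Hypothesis PQJ : {in A, forall a, ('D_(e_ j) P a, 'D_(e_ j) Q a) =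
   nkJ (P a) (Q a) ('D_(e_ i) P a, 'D_(e_ i) Q a)}.

Lemma logd_second_factor : {in A, forall a,
  logd Q i a = 2^-1 *: (logd P i a + s *: logd P j a) /\
  logd Q j a = 2^-1 *: (logd P j a - s *: logd P i a)}.
Proof.
move=> a aA; apply: nkJ_frame (P1 a aA) (Q1 a aA) _.
have LP k := ltrans_logd A oA P k a sP P1 aA.
have LQ k := ltrans_logd A oA Q k a sQ Q1 aA.
apply: (etrans (congr2 pair (LP j) (LQ j))); apply: (etrans (PQJ a aA)).
exact: esym (congr2 (fun x y => nkJ (P a) (Q a) (x, y)) (LP i) (LQ i)).
Qed.

(** The Maurer-Cartan equation of the second factor, whose logarithmic
    derivatives are combinations of those of the first one, yields an equation
    independent of that of the first factor. *)
Lemma divergence_logd : {in A, forall a,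
  'D_(e_ i) (logd P i) a + 'D_(e_ j) (logd P j) a =
  (2 / s) *: cross (logd P i a) (logd P j a)}.
Proof.
move=> a aA.
have mcP := maurer_cartan A oA P i j a sP P1 aA.
have mcQ := maurer_cartan A oA Q i j a sQ Q1 aA.
have dP k l : is_derive a (e_ k) (logd P l) ('D_(e_ k) (logd P l) a).
  by apply: derivableP; exact: smooth_on_derivable (smooth_logd A oA P l sP) _ aA.
have dQi : 'D_(e_ j) (logd Q i) a =
    2^-1 *: ('D_(e_ j) (logd P i) a + s *: 'D_(e_ j) (logd P j) a).
  have [_ <-] : is_derive a (e_ j) (2^-1 \*: (logd P i + s \*: logd P j))
      (2^-1 *: ('D_(e_ j) (logd P i) a + s *: 'D_(e_ j) (logd P j) a)).
    exact: is_deriveZ (is_deriveD (dP j i) (is_deriveZ _ (dP j j))).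
  apply: near_eq_derive; apply: (near_open _ _ _ _ oA aA) => x xA.
  exact: (proj1 (logd_second_factor x xA)).
have dQj : 'D_(e_ i) (logd Q j) a =
    2^-1 *: ('D_(e_ i) (logd P j) a - s *: 'D_(e_ i) (logd P i) a).
  have [_ <-] : is_derive a (e_ i) (2^-1 \*: (logd P j - s \*: logd P i))
      (2^-1 *: ('D_(e_ i) (logd P j) a - s *: 'D_(e_ i) (logd P i) a)).
    exact: is_deriveZ (is_deriveB (dP i j) (is_deriveZ _ (dP i i))).
  apply: near_eq_derive; apply: (near_open _ _ _ _ oA aA) => x xA.
  exact: (proj2 (logd_second_factor x xA)).
apply: frame_divergence mcP _.
have [<- <-] := logd_second_factor a aA.
by apply: etrans mcQ; rewrite -dQi -dQj.
Qed.

End NearlyKaehlerSurface.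

(** * Mean curvature in isothermal coordinates *)

Section SurfacesInSpaceGeometry.
Context {R : realType} {M : topologicalType}.

Lemma ord2P (i : 'I_2) : i = 0 \/ i = 1.
Proof. by case: i => -[|[|//]] hi; [left|right]; apply: val_inj. Qed.

(** With first fundamental form [E] times the identity, the cross product of the
    coordinate fields has length [E], so that the two factors [E^-1] coming from
    the metric and from the normalization cancel against its square. *)
Lemma mean_curvature_isothermal (c : chart R M) (f : M -> 'rV[R]_3) (H : R) m :
  dot (pd_u c f m) (pd_u c f m) = dot (pd_v c f m) (pd_v c f m) ->
  dot (pd_u c f m) (pd_v c f m) = 0 -> pd_u c f m != 0 ->
  pd_u c (pd_u c f) m + pd_v c (pd_v c f) m =
    (2 * H) *: cross (pd_u c f m) (pd_v c f m) ->
  mean_curvature c f m = H.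
Proof.
move=> huv h0 nz lap; rewrite /mean_curvature.
have ff : first_form c f m = (dot (pd_u c f m) (pd_u c f m))%:M.
  apply/matrixP => i j; rewrite !mxE.
  case: (ord2P i) => ->; case: (ord2P j) => ->; rewrite /= ?mulr1n ?mulr0n.
  - exact: erefl.
  - exact: h0.
  - by rewrite dotC.
  - exact: esym huv.
have sf : \tr (second_form c f m) =
    dot (pd_u c (pd_u c f) m + pd_v c (pd_v c f) m) (unit_normal c f m).
  rewrite linearDl /mxtrace !big_ord_recl big_ord0 addr0 !mxE.
  by congr (_ + dot (pd c _ (pd c _ f) m) _); exact: val_inj.
rewrite ff invmx_scalar mul_scalar_mx mxtraceZ sf lap /unit_normal {ff sf lap} /=.
move: (pd_u c f m) (pd_v c f m) huv h0 nz => u v huv h0 nz.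
have E0 : 0 < dot u u.
  by rewrite lt_def dot_ge0 andbT; apply: contra_neq nz => /dot_eq0.
rewrite dotZZ lagrange3 h0 -huv.
move: (dot u u) E0 => E E0.
rewrite expr0n /= subr0 -expr2 sqrtr_sqr gtr0_norm // /GRing.scale /=.
by field; exact: lt0r_neq0.
Qed.

End SurfacesInSpaceGeometry.

(** * The associated map *)

Section AssociatedMap.
Context {R : realType} {M : topologicalType}.
Variables (S : smooth_surface R M) (p q : M -> quat R) (eps : M -> 'rV[R]_3)
  (c : chart R M).
Hypotheses (acs : almost_complex_surface S p q) (assoc : associated_map S p q eps).
Hypotheses (cS : charts S c) (ciso : isothermal_adapted c p q).
Local Notation s := (Num.sqrt 3 : R).
Local Notation e_ i := (delta_mx 0 i : 'rV[R]_2).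
Local Notation A := (c @` cdom c).
Local Notation P := (p \o cinv c).
Local Notation Q := (q \o cinv c).

Let oA : open A := @cimg_open _ _ c.

Lemma chartA m : cdom c m -> c m \in A.
Proof. by move=> cm; rewrite inE; exists m. Qed.

Lemma chartK m : cdom c m -> cinv c (c m) = m.
Proof. by move=> cm; apply: cmapK; rewrite inE. Qed.

Lemma chartP a : a \in A -> exists2 m, cdom c m & a = c m.
Proof. by rewrite inE => -[m cm <-]; exists m. Qed.

Let sP : smooth_on A P. Proof. by case: acs => -[_ sp _ _] _; exact: sp. Qed.
Let sQ : smooth_on A Q. Proof. by case: acs => -[_ _ sq _] _; exact: sq. Qed.

Let P1 : {in A, forall a, dot (P a) (P a) = 1}.
Proof. by move=> a _; case: acs => -[/(_ (cinv c a))[]]. Qed.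
Let Q1 : {in A, forall a, dot (Q a) (Q a) = 1}.
Proof. by move=> a _; case: acs => -[/(_ (cinv c a))[]]. Qed.

Let PQJ : {in A, forall a, ('D_(e_ 1) P a, 'D_(e_ 1) Q a) =
   nkJ (P a) (Q a) ('D_(e_ 0) P a, 'D_(e_ 0) Q a)}.
Proof.
move=> a /chartP[m cm ->]; case: (ciso m cm) => _ _.
by rewrite /dphi /pd /= (chartK m cm).
Qed.

(** The forms alpha and beta as functions on the coordinate domain, with the
    values of cos theta and sin theta substituted. *)
Definition eps_partial (i : 'I_2) (a : 'rV[R]_2) : 'rV[R]_3 :=
  if i == 0 then - 2^-1 *: logd P 0 a + (s / 2) *: logd P 1 a
  else - (s / 2) *: logd P 0 a + (- 2^-1) *: logd P 1 a.

Lemma smooth_eps_partial i : smooth_on A (eps_partial i).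
Proof.
by rewrite /eps_partial; case: (i == 0) => k; apply: Ck_onD => //; apply: Ck_onZ => //;
  exact: smooth_logd.
Qed.

Lemma is_derive_eps i : {in A, forall a, is_derive a (e_ i) (eps \o cinv c) (eps_partial i a)}.
Proof.
move=> a /chartP[m cm ->]; have [d0 d1] := assoc c cS ciso m cm.
have pm1 : dot (p m) (p m) = 1 by case: acs => -[/(_ m)[]].
have tE (k : 'I_2) : qim (qmul (qinv (p m)) (pd c k p m)) = logd P k (c m).
  by rewrite /logd /qlog /= (chartK m cm) qinv_unit.
have aE : alpha c p m = eps_partial 0 (c m).
  rewrite /alpha cos_theta sin_theta.
  exact: (congr2 (fun u v => - 2^-1 *: u + (s / 2) *: v) (tE 0) (tE 1)).
have bE : beta c p m = eps_partial 1 (c m).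
  rewrite /beta cos_theta sin_theta.
  exact: (congr2 (fun u v => - (s / 2) *: u + (- 2^-1) *: v) (tE 0) (tE 1)).
by case: (ord2P i) => ->; [rewrite -aE|rewrite -bE].
Qed.

Lemma smooth_eps : smooth_on A (eps \o cinv c).
Proof. exact: smooth_on_of_partials oA smooth_eps_partial is_derive_eps. Qed.

Lemma pd_eps i m : cdom c m -> pd c i eps m = eps_partial i (c m).
Proof. by move=> cm; case: (is_derive_eps i (c m) (chartA m cm)). Qed.

Lemma pd_pd_eps i m : cdom c m -> pd c i (pd c i eps) m = 'D_(e_ i) (eps_partial i) (c m).
Proof.
move=> cm; apply: near_eq_derive; apply: (near_open _ _ _ _ oA (chartA m cm)) => a aA.
by have [n cn ->] := chartP a aA; rewrite /= chartK // pd_eps.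
Qed.

(** [Lambda] is -2 times the complex square of (eps_u - i eps_v) / 2: the factor
    1 + i sqrt 3 = 2 e^(i pi/3) found for the frame (alpha~, beta~) is turned into
    -2 by the rotation of the frame through 2 pi/3, which multiplies the complex
    square by e^(4 i pi/3). *)
Lemma Lambda_epsE m : cdom c m ->
  Lambda c p q m =
  Complex (- (dot (pd_u c eps m) (pd_u c eps m) - dot (pd_v c eps m) (pd_v c eps m)) / 2)
          (dot (pd_u c eps m) (pd_v c eps m)).
Proof.
move=> cm; have mA := chartA m cm.
have pm : P (c m) = p m by rewrite /= chartK.
have qm : Q (c m) = q m by rewrite /= chartK.
have LP k : pd c k p m = ltrans (p m) (logd P k (c m)).
  by rewrite -pm; exact: esym (ltrans_logd A oA P k _ sP P1 mA).
have LQ k : pd c k q m = ltrans (q m) (logd Q k (c m)).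
  by rewrite -qm; exact: esym (ltrans_logd A oA Q k _ sQ Q1 mA).
have [q0 q1] := logd_second_factor A P Q 0 1 oA sP sQ P1 Q1 PQJ (c m) mA.
rewrite /Lambda /phi_z /dphi (LP 0) (LP 1) (LQ 0) (LQ 1) q0 q1 !pd_eps // /eps_partial /=.
rewrite nkgC_nkPC_frame; last 2 first.
- by rewrite -pm; exact: P1.
- by rewrite -qm; exact: Q1.
move: (logd P 0 (c m)) (logd P 1 (c m)) => u v.
have := @sqr_sqrt3 R; move: s => r r3.
by congr Complex; coords; field: r3.
Qed.

Lemma eps_laplacian m : cdom c m ->
  pd_u c (pd_u c eps) m + pd_v c (pd_v c eps) m =
  (2 * (- 2 / s)) *: cross (pd_u c eps m) (pd_v c eps m).
Proof.
move=> cm; have mA := chartA m cm.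
rewrite !pd_pd_eps // !pd_eps //.
have mc := maurer_cartan A oA P 0 1 (c m) sP P1 mA.
have dv := divergence_logd A P Q 0 1 oA sP sQ P1 Q1 PQJ (c m) mA.
have dP k l : is_derive (c m) (e_ k) (logd P l) ('D_(e_ k) (logd P l) (c m)).
  by apply: derivableP; exact: smooth_on_derivable (smooth_logd A oA P l sP) _ mA.
have [_ D0] : is_derive (c m) (e_ 0) (- 2^-1 \*: logd P 0 + (s / 2) \*: logd P 1)
    (- 2^-1 *: 'D_(e_ 0) (logd P 0) (c m) + (s / 2) *: 'D_(e_ 0) (logd P 1) (c m)).
  exact: is_deriveD (is_deriveZ _ (dP 0 0)) (is_deriveZ _ (dP 0 1)).
have [_ D1] : is_derive (c m) (e_ 1) (- (s / 2) \*: logd P 0 + (- 2^-1) \*: logd P 1)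
    (- (s / 2) *: 'D_(e_ 1) (logd P 0) (c m) + (- 2^-1) *: 'D_(e_ 1) (logd P 1) (c m)).
  exact: is_deriveD (is_deriveZ _ (dP 1 0)) (is_deriveZ _ (dP 1 1)).
apply: (etrans (congr2 +%R D0 D1)).
exact: (rotated_laplacian _ _ _ _ _ _ mc dv).
Qed.

(** If eps_u vanishes then so does eps_v, hence both logarithmic derivatives of
    [p], hence those of [q]; this contradicts that (p, q) is an immersion. *)
Lemma eps_immersed m : cdom c m ->
  dot (pd_u c eps m) (pd_u c eps m) = dot (pd_v c eps m) (pd_v c eps m) ->
  pd_u c eps m != 0.
Proof.
move=> cm huv; apply/eqP => u0; have mA := chartA m cm.
have v0 : pd_v c eps m = 0.
  by apply: dot_eq0; rewrite -huv u0 linear0l.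
have [l0 l1] : logd P 0 (c m) = 0 /\ logd P 1 (c m) = 0.
  apply: rotated_frame_eq0; first exact: (etrans (esym (pd_eps 0 m cm)) u0).
  exact: (etrans (esym (pd_eps 1 m cm)) v0).
have [q0 _] := logd_second_factor A P Q 0 1 oA sP sQ P1 Q1 PQJ (c m) mA.
have pz : pd_u c p m = 0.
  apply: etrans (esym (ltrans_logd A oA P 0 _ sP P1 mA)) _.
  by rewrite l0 /ltrans; coords; ring.
have qz : pd_u c q m = 0.
  apply: etrans (esym (ltrans_logd A oA Q 0 _ sQ Q1 mA)) _.
  by rewrite q0 l0 l1 /ltrans; coords; ring.
case: acs => -[_ _ _ /(_ c m cS cm 1 0)] + _.
rewrite /dphi pz qz scale0r addr0 scale1r => /(_ erefl)[/eqP].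
by rewrite oner_eq0.
Qed.

End AssociatedMap.

Theorem theorem3p10 (R : realType) (M : topologicalType)
    (S : smooth_surface R M) (p q : M -> quat R) (eps : M -> 'rV[R]_3)
    (c : chart R M) :
  simply_connected R M ->
  almost_complex_surface S p q ->
  associated_map S p q eps ->
  charts S c -> isothermal_adapted c p q ->
  (isothermal_on c eps <->
     (forall m : M, cdom c m -> Lambda c p q m = 0)) /\
  ((forall m : M, cdom c m -> Lambda c p q m = 0) ->
     immersed_in_chart c eps /\
     (forall m : M, cdom c m -> mean_curvature c eps m = - 2 / Num.sqrt 3)).
Proof.
move=> _ acs assoc cS ciso.
have LE := Lambda_epsE S p q eps c acs assoc cS ciso.
have iso_iff : isothermal_on c eps <-> (forall m, cdom c m -> Lambda c p q m = 0).
  by split=> h m cm; [rewrite (LE m cm); apply/Complex_conformal_eq0|apply/Complex_conformal_eq0; rewrite -(LE m cm)];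
    exact: h.
split=> // /iso_iff iso.
have nz m : cdom c m -> pd_u c eps m != 0.
  by move=> cm; apply: (eps_immersed S p q eps c acs assoc cS ciso m cm);
    case: (iso m cm).
split; last first.
  move=> m cm; have [huv h0] := iso m cm.
  exact: (mean_curvature_isothermal c eps _ m huv h0 (nz m cm)
    (eps_laplacian S p q eps c acs assoc cS ciso m cm)).
split; first exact: (smooth_eps S p q eps c acs assoc cS ciso).
move=> m cm a b; have [huv h0] := iso m cm.
exact: conformal_free huv h0 (nz m cm).
Qed.
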